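(* There exists an absolute constant $C>0$ such that for all real $0<\alpha,\beta<1$ and all integers $w\ge 2$, $$\kappa(w,\alpha,\beta)\ \le\ \frac{C}{\alpha^2}\left(\log w\,\log\log w+\Big(\log\frac1\beta\Big)^2\right).$$
   Context: A set system on a finite set $X$ is a collection of subsets of $X$; it is a $w$-set system if each of its sets has size at most $w$. For $0<p<1$, $\mathcal U(X,p)$ denotes the distribution of a random subset of $X$ in which each element is included independently with probability $p$. For $0<\alpha,\beta<1$, a set system $\mathcal F$ on $X$ is $(\alpha,\beta)$-satisfying if $\Pr_{R\sim\mathcal U(X,\alpha)}[\exists S\in\mathcal F,\ S\subset R]>1-\beta$. A weighted set system is a pair $(\mathcal F,\sigma)$ where $\mathcal F$ is a set system and $\sigma:\mathcal F\to\mathbb Q_{\ge0}$ is not identically $0$; write $\sigma(\mathcal F')=\sum_{S\in\mathcal F'}\sigma(S)$ for $\mathcal F'\subset\mathcal F$. For $T\subset X$ the link of $\mathcal F$ at $T$ is $\mathcal F_T=\{S\setminus T:S\in\mathcal F,T\subset S\}$, and $\sigma(\mathcal F_T)$ means $\sum_{S\in\mathcal F,\,S\supset T}\sigma(S)$. A weight profile is a vector $\mathbf s=(s_0;s_1,\dots,s_k)$ of reals with $s_0\ge s_1\ge\cdots\ge s_k\ge0$ and $s_0>0$; by convention $s_i=0$ for $i>k$. For a weight profile $\mathbf s=(s_0;s_1,\dots,s_w)$, $(\mathcal F,\sigma)$ is $\mathbf s$-spread if (i) $\sigma(\mathcal F)\ge s_0$ and (ii) $\sigma(\mathcal F_T)\le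 s_{|T|}$ for every non-empty $T$ (in particular $\mathcal F$ is a $w$-set system). A set system $\mathcal F$ is $\mathbf s$-spread if there is a weight function $\sigma$ such that $(\mathcal F,\sigma)$ is $\mathbf s$-spread. A weight profile $\mathbf s$ is $(\alpha,\beta)$-satisfying if every $\mathbf s$-spread set system (on any finite ground set) is $(\alpha,\beta)$-satisfying. For $0<\alpha,\beta<1$ and $w\ge2$, $\kappa(w,\alpha,\beta)$ is the least (i.e. the infimum of all) $\kappa\ge1$ such that the weight profile $(1;\kappa^{-1},\dots,\kappa^{-w})$ is $(\alpha,\beta)$-satisfying. Convention: $\log$ denotes the logarithm in base $1.9$, so that $\log\log w>0$ for $w\ge 2$. *)

(* Defs.v *)
From HB Require Import structures.
From mathcomp Require Import all_boot all_order all_algebra.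
From mathcomp Require Import all_classical all_reals all_analysis.

Set Implicit Arguments.
Unset Strict Implicit.
Unset Printing Implicit Defensive.

Import Order.TTheory GRing.Theory Num.Theory.
Local Open Scope classical_set_scope.
Local Open Scope ring_scope.

Section SetSystems.
Variables (R : realType) (X : finType).
Implicit Types (p alpha beta : R) (F : {set {set X}}) (sigma : {set X} -> rat).

(* Mass function of U(X, p): the product form is the independence of the
   events [x \in W], each of probability p. *)
Definition random_subset_pmf p (W : {set X}) : R :=
  \prod_(x : X) (if x \in W then p else 1 - p).

Definition random_subset_prob p (E : pred {set X}) : R :=
  \sum_(W : {set X} | E W) random_subset_pmf p W.

Definition satisfying alpha beta F : Prop :=
  1 - beta <
  random_subset_prob alpha (fun W => [exists S : {set X} in F, S \subset W]).

(* Only the values of sigma on F matter. *)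
Definition weighted_set_system F sigma : Prop :=
  (forall S, S \in F -> 0 <= sigma S) /\
  (exists2 S, S \in F & sigma S != 0).

Definition weight F sigma : rat := \sum_(S in F) sigma S.

(* The weight of the link of F at T: each member S \ T is counted with the
   weight of the set S of F it comes from. *)
Definition link_weight F sigma (T : {set X}) : rat :=
  \sum_(S in F | T \subset S) sigma S.

(* A weight profile (s_0; s_1, ..., s_k) is the sequence of its entries; the
   default value of [s`_i] provides the convention s_i = 0 for i > k.
   Hence positive-weight sets have size at most k. *)
Definition weighted_spread (s : seq R) F sigma : Prop :=
  [/\ weighted_set_system F sigma,
      s`_0 <= ratr (weight F sigma) &
      forall T : {set X}, T != finset.set0 ->
        ratr (link_weight F sigma T) <= s`_(#|T|)].

Definition spread (s : seq R) F : Prop := exists sigma, weighted_spread s F sigma.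

End SetSystems.

Definition weight_profile (R : realType) (s : seq R) : Prop :=
  [/\ 0 < s`_0, sorted >=%R s & all (fun x => 0 <= x) s].

Definition profile_satisfying (R : realType) (alpha beta : R) (s : seq R) : Prop :=
  weight_profile s /\
  forall (X : finType) (F : {set {set X}}), spread s F -> satisfying alpha beta F.

Definition geometric_profile (R : realType) (w : nat) (k : R) : seq R :=
  mkseq (fun i => k ^- i) w.+1.

(* The infimum is taken in the extended reals, so that it is +oo, and not a
   junk real number, if no k is admissible. *)
Definition kappa (R : realType) (w : nat) (alpha beta : R) : \bar R :=
  ereal_inf [set k%:E | k in
    [set k : R | 1 <= k /\
                 profile_satisfying alpha beta (geometric_profile w k)]].

Definition log (R : realType) (x : R) : R := ln x / ln (19 / 10).

(* Main.v *)
Require Import Defs.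
From mathcomp Require Import all_boot all_order all_algebra.
From mathcomp Require Import all_classical all_reals all_analysis.
From mathcomp Require Import fintype finset ring lra.

Set Implicit Arguments.
Unset Strict Implicit.
Unset Printing Implicit Defensive.

Import Order.TTheory GRing.Theory Num.Theory.
Local Open Scope ring_scope.

(** The proof is the expectation form of the Park-Pham argument for the
    Kahn-Kalai conjecture, run with product measures.

    Fix p = 1/kappa and let [mincost p H] be the least value of the sum of
    p^|T| over a family of sets T such that every member of H contains one of
    them.  Spreadness is used only once: charging each member of F to a set of
    the cover that it contains gives 1 <= sum of kappa^-|T| for every cover,
    that is [mincost = 1] (lemma [mincost_spread]).  It remains to see that a
    random set contains a member of any H whose members are bounded in size and
    whose cost is 1.

    Expose a random set W of density r.  The inclusion-minimal sets S \ W, with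
    S in H, cover H.  Suppose that the members of H have fewer than 2m
    elements.  The minimal sets with at least m elements are cheap on average
    ([expected_fragments_cost]): T is recovered from W :|: T as one of at most
    4^m subsets of one fixed member of H inside W :|: T, and passing from W to
    W :|: T costs a factor of at most r^|T| in probability, so their expected
    cost is at most (4p/r)^m.  The small ones form a system with members of
    size less than m, on which one recurses with fresh randomness.  Hence if the probability
    of missing is at most a + b (1 - mincost) for size bound m, the same holds
    for size bound 2m, with a increased by b (4p/r)^m
    ([miss_bound_double]).  The form a + b (1 - mincost) is linear in the cost,
    so it passes through expectations with no loss.

    With r = 32p the increments are 8^-m.  Starting from systems with no
    member other than the empty set, K rounds handle sets smaller than 2^K and
    miss with probability at most 1/4 when the cost is 1.  Repeating these K rounds K times
    independently brings the bound down to (3/4)^K ([miss_bound_boost]), and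
    N more rounds of doubling, with 2^N > w, then cost only about 8^-K in
    total.  The density used is 32p(K^2 + N), where K is of order 1 + log(1/beta)
    and N of order log w; setting it equal to alpha gives kappa of order
    (log w + log(1/beta)^2) / alpha, and log log w is bounded below for
    w >= 2. *)

(** * Random subsets and the probability of missing a set system *)

Section RandomSubset.
Variables (R : realType) (X : finType).
Implicit Types (p q r a b : R) (A B T W Z : {set X}) (H G : {set {set X}}).

Lemma random_subset_pmf_ge0 q W : 0 <= q <= 1 -> 0 <= random_subset_pmf q W.
Proof.
move=> /andP[q0 q1]; apply: prodr_ge0 => x _.
by case: ifP => _ //; rewrite subr_ge0.
Qed.

Lemma sum_random_subset_pmf q : \sum_(W : {set X}) random_subset_pmf q W = 1 :> R.
Proof.
rewrite -(bigA_distr _ _ (fun=> q) (fun=> 1 - q)) big1 // => x _ /=.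
by rewrite addrC subrK.
Qed.

(** The union of independent random subsets of densities q and r has density
    1 - (1 - q)(1 - r).  The product over the points is expanded over the
    possible traces A and B of the two subsets. *)
Lemma random_subset_pmf_setU q r Z :
  random_subset_pmf (1 - (1 - q) * (1 - r)) Z =
  \sum_(A : {set X}) \sum_(B : {set X} | A :|: B == Z) random_subset_pmf q A * random_subset_pmf r B.
Proof.
pose u A x : R := if x \in A then q else 1 - q.
pose z x : R := (x \in Z)%:R.
have -> : random_subset_pmf (1 - (1 - q) * (1 - r)) Z =
    \prod_x (q * z x + (1 - q) * (if x \in Z then r else 1 - r)).
  apply: eq_bigr => x _; rewrite /z; case: ifP => _ /=; ring.
rewrite bigA_distr /=; apply: eq_bigr => A _.
(* The choice x \in A is made; split each factor again according to x \in B,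
   keeping an indicator that the membership of x in A :|: B agrees with Z. *)
have -> : \prod_x (if x \in A then q * z x
                   else (1 - q) * (if x \in Z then r else 1 - r)) =
    \prod_x (u A x * r * z x +
             u A x * (1 - r) * (~~ ((x \in A) (+) (x \in Z)))%:R).
  apply: eq_bigr => x _; rewrite /z /u.
  by case: (x \in A) (x \in Z) => [] [] /=; ring.
rewrite bigA_distr /= [RHS]big_mkcond /=; apply: eq_bigr => B _.
case: eqP => [ABZ | ABZ].
  rewrite -big_split /=; apply: eq_bigr => x _; rewrite /z /u -ABZ in_setU.
  by case: (x \in A) (x \in B) => [] [] /=; ring.
have [x xP] : exists x, (x \in A :|: B) != (x \in Z).
  apply/existsP; apply: contra_notT ABZ => /existsPn xP; apply/setP => x.
  by have := xP x; rewrite negbK => /eqP.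
rewrite (bigD1 x) //= /z; move: xP; rewrite in_setU.
by case: (x \in A) (x \in B) (x \in Z) => [] [] [] //= _; rewrite !mulr0 mul0r.
Qed.

Lemma expectation_setU q r (f : {set X} -> R) :
  \sum_(Z : {set X}) random_subset_pmf (1 - (1 - q) * (1 - r)) Z * f Z =
  \sum_(A : {set X}) random_subset_pmf q A * \sum_(B : {set X}) random_subset_pmf r B * f (A :|: B).
Proof.
under eq_bigr => Z _.
  rewrite random_subset_pmf_setU mulr_suml.
  under eq_bigr do rewrite mulr_suml.
  over.
rewrite exchange_big /=; apply: eq_bigr => A _.
rewrite mulr_sumr (exchange_big_dep xpredT) //=; apply: eq_bigr => B _.
by rewrite (big_pred1 (A :|: B)) ?mulrA // => Z; rewrite eq_sym.
Qed.

(** Adding the points of T costs a factor of at most q^|T| in probability, to be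
    compared with the weight p^|T| of a fragment T in the cost of a cover. *)
Lemma random_subset_pmf_le_setU q W T : 0 <= q <= 1 -> [disjoint W & T] ->
  random_subset_pmf q W * q ^+ #|T| <= random_subset_pmf q (W :|: T).
Proof.
move=> /andP[q0 q1] /pred0P dWT.
have -> : q ^+ #|T| = \prod_x (if x \in T then q else 1).
  by rewrite -big_mkcond prodr_const.
rewrite -big_split /=; apply: ler_prod => x _.
have := dWT x; rewrite /= in_setU.
case: (x \in W) (x \in T) => [] [] //= _; nra.
Qed.

Definition hits H : pred {set X} := fun W => [exists S : {set X} in H, S \subset W].

Definition miss q H : R := \sum_(W : {set X}) random_subset_pmf q W * (~~ hits H W)%:R.

Lemma hitsW H W Z : W \subset Z -> hits H W -> hits H Z.
Proof.
move=> WZ /exists_inP[S SH SW]; apply/exists_inP; exists S => //.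
exact: subset_trans SW WZ.
Qed.

Lemma random_subset_prob_hits q H : random_subset_prob q (hits H) = 1 - miss q H.
Proof.
rewrite -(sum_random_subset_pmf q) /miss /random_subset_prob.
rewrite -sumrB big_mkcond; apply: eq_bigr => W _.
by case: (hits H W) => /=; rewrite ?mulr0 ?mulr1 ?subr0 ?subrr.
Qed.

Lemma miss_ge0 q H : 0 <= q <= 1 -> 0 <= miss q H.
Proof.
by move=> q01; apply: sumr_ge0 => W _; rewrite mulr_ge0 ?random_subset_pmf_ge0.
Qed.

Lemma miss_le1 q H : 0 <= q <= 1 -> miss q H <= 1.
Proof.
move=> q01; rewrite -(sum_random_subset_pmf q); apply: ler_sum => W _.
by rewrite ler_piMr ?random_subset_pmf_ge0 // lern1; case: (~~ _).
Qed.

(** A union of two random subsets misses H only if both of them do, and these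
    are independent. *)
Lemma miss_setU q r H : 0 <= q <= 1 -> 0 <= r <= 1 ->
  miss (1 - (1 - q) * (1 - r)) H <= miss q H * miss r H.
Proof.
move=> q01 r01; rewrite /miss expectation_setU mulr_suml.
apply: ler_sum => A _; rewrite -mulrA ler_wpM2l ?random_subset_pmf_ge0 //.
rewrite mulr_sumr; apply: ler_sum => B _.
rewrite mulrCA ler_wpM2l ?random_subset_pmf_ge0 // -natrM mulnb ler_nat.
case hAB: (hits H (A :|: B)) => //=.
have -> : ~~ hits H A by apply: contraFN hAB; apply: hitsW; rewrite subsetUl.
have -> // : ~~ hits H B by apply: contraFN hAB; apply: hitsW; rewrite subsetUr.
Qed.

(** The random subset of density r is a union of one of density q and an
    independent one of density t. *)
Lemma miss_anti q r H : 0 <= q -> q <= r -> r <= 1 -> miss r H <= miss q H.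
Proof.
move=> q0 qr r1; have q1 := le_trans qr r1.
have [->//|qNr] := eqVneq q r.
have lt_qr : q < r by rewrite lt_neqAle qNr.
have q1' : 0 < 1 - q by lra.
pose t := (r - q) / (1 - q).
have t01 : 0 <= t <= 1.
  by rewrite divr_ge0 ?subr_ge0 //= ler_pdivrMr // mul1r lerD2r.
have -> : r = 1 - (1 - q) * (1 - t) by rewrite /t; field; rewrite gt_eqF.
rewrite (le_trans (miss_setU H _ t01)) ?q0 //.
by rewrite ler_piMr ?miss_le1 ?miss_ge0 ?q0.
Qed.

Lemma missD q r H : 0 <= q -> 0 <= r -> q + r <= 1 ->
  miss (q + r) H <= miss (1 - (1 - q) * (1 - r)) H.
Proof. by move=> q0 r0 qr1; apply: miss_anti => //; nra. Qed.

Lemma miss_mulrn q H k : 0 <= q -> q *+ k <= 1 -> miss (q *+ k) H <= miss q H ^+ k.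
Proof.
move=> q0; elim: k => [|k IH] qk1.
  by rewrite miss_le1 // lexx ler01.
have qk0 : 0 <= q *+ k by rewrite mulrn_wge0.
have qk : q <= 1 /\ q *+ k <= 1 by move: qk1; rewrite mulrS; lra.
have [q1 qk1'] := qk.
rewrite mulrS in qk1 *.
rewrite (le_trans (missD H q0 qk0 qk1)) // exprS.
rewrite (le_trans (miss_setU H _ _)) ?q0 ?qk0 //.
by rewrite ler_wpM2l ?miss_ge0 ?q0 ?IH.
Qed.

End RandomSubset.

(** * Covers, minimal fragments and one round of exposure *)

Section MinCost.
Variables (R : realType) (X : finType).
Implicit Types (p q r a b : R) (A B S T W Z : {set X}) (H G U : {set {set X}}).

Definition covers G H := [forall S in H, exists T in G, T \subset S].

Definition cost p G : R := \sum_(T in G) p ^+ #|T|.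

(** Capping at 1 does not change the minimum over all covers, since the empty
    set alone is a cover of cost 1. *)
Definition mincost p H : R := \big[Order.min/1]_(G : {set {set X}} | covers G H) cost p G.

Lemma coversP G H :
  reflect (forall S, S \in H -> exists2 T, T \in G & T \subset S) (covers G H).
Proof.
apply: (iffP forall_inP) => [GH S /GH /exists_inP //|GH S /GH GS].
exact/exists_inP.
Qed.

Lemma cost_ge0 p G : 0 <= p -> 0 <= cost p G.
Proof. by move=> p0; apply: sumr_ge0 => T _; rewrite exprn_ge0. Qed.

Lemma cost_setU p G U : 0 <= p -> cost p (G :|: U) <= cost p G + cost p U.
Proof.
move=> p0; rewrite /cost (big_setID G) /= setUK lerD2l setDUl setDv set0U.
rewrite [leRHS](big_setID G) /= lerDr.
by apply: sumr_ge0 => T _; rewrite exprn_ge0.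
Qed.

Lemma mincost_le1 p H : mincost p H <= 1.
Proof. exact: bigmin_le_id. Qed.

Lemma mincost_le_cost p G H : covers G H -> mincost p H <= cost p G.
Proof.
exact: (@bigmin_le_cond _ _ _ 1 G (covers^~ H) (cost p)).
Qed.

Lemma mincost_set0 p : mincost p set0 <= 0.
Proof.
have c0 : covers set0 set0 by apply/coversP => S; rewrite inE.
by rewrite (le_trans (mincost_le_cost p c0)) // /cost big_set0.
Qed.

Lemma mincost_split p H H' U : 0 <= p ->
    (forall S, S \in H -> exists2 T, T \in H' :|: U & T \subset S) ->
  mincost p H <= cost p U + mincost p H'.
Proof.
move=> p0 HU; rewrite -lerBlDl; apply: le_bigmin => [|G /coversP GH'].
  by rewrite lerBlDr (le_trans (mincost_le1 p H)) // lerDl cost_ge0.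
rewrite lerBlDr (le_trans _ (cost_setU G U p0)) // mincost_le_cost //.
apply/coversP => S /HU [T]; rewrite inE => /orP[/GH'[V VG VT]|TU] TS.
  by exists V; [rewrite inE VG | apply: subset_trans TS].
by exists T; [rewrite inE TU orbT | ].
Qed.

(** These are Park and Pham's minimum fragments, except that minimality is with
    respect to inclusion, which makes them independent of a starting member
    of H. *)
Definition fragments H W := [set T | minset [in [set S :\: W | S in H]] T].

Lemma fragmentsP H W T : T \in fragments H W ->
  [/\ exists2 S, S \in H & T = S :\: W, [disjoint W & T] &
      forall S, S \in H -> S :\: W \subset T -> S :\: W = T].
Proof.
rewrite inE => /minsetP[/imsetP[S SH ->] minT]; split; first by exists S.
  by rewrite disjoint_sym disjoints_subset setDE subsetIr.
by move=> S' S'H; apply: minT; apply/imsetP; exists S'.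
Qed.

Lemma fragments_sub H W S : S \in H ->
  exists2 T, T \in fragments H W & T \subset S.
Proof.
move=> SH.
have SW : S :\: W \in [set S0 :\: W | S0 in H] by apply/imsetP; exists S.
have [T minT TS] := minset_exists SW.
exists T; first by rewrite inE.
by apply: subset_trans TS _; apply: subsetDl.
Qed.

(** This is what makes the fragment T easy to recover from W :|: T: it is a
    subset of whichever member of H one finds in W :|: T. *)
Lemma fragment_sub_edge H W T S : T \in fragments H W -> S \in H ->
  S \subset W :|: T -> T \subset S.
Proof.
case/fragmentsP => _ _ minT SH; rewrite -subDset => /(minT _ SH) <-.
exact: subsetDl.
Qed.

(** The pairs (W, T) are counted through (W :|: T, T).  Given Z = W :|: T, the
    fragment T is a subset of one member of H chosen as a function of Z, which
    leaves at most 4^m possibilities, and each pair weighs at most (p/q)^m times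
    the probability of Z. *)
Lemma expected_fragments_cost p q H m : 0 < p <= q -> q <= 1 ->
    (forall S, S \in H -> (#|S| < 2 * m)%N) ->
  \sum_(W : {set X}) random_subset_pmf q W *
      cost p [set T in fragments H W | (m <= #|T|)%N]
    <= (4 * p / q) ^+ m.
Proof.
move=> /andP[p0 pq] q1 Hm; have q0 : 0 < q := lt_le_trans p0 pq.
have q01 : 0 <= q <= 1 by rewrite (ltW q0).
pose edge Z := odflt set0 [pick S in H | S \subset Z].
have edgeP Z S : S \in H -> S \subset Z -> edge Z \in H /\ edge Z \subset Z.
  move=> SH SZ; rewrite /edge; case: pickP => [V /andP[]//|/(_ S)].
  by rewrite SH SZ.
have edge_size Z : (#|edge Z| <= 2 * m)%N.
  rewrite /edge; case: pickP => [S /andP[/Hm /ltnW //]|_].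
  by rewrite cards0.
have pq01 : 0 <= p / q <= 1.
  by rewrite divr_ge0 ?(ltW p0) ?(ltW q0) //= ler_pdivrMr // mul1r.
pose D T := [set W : {set X} | (T \in fragments H W) && (m <= #|T|)%N].
pose E T := [set Z : {set X} | (T \subset edge Z) && (m <= #|T|)%N].
have -> : \sum_(W : {set X}) random_subset_pmf q W *
      cost p [set T in fragments H W | (m <= #|T|)%N] =
    \sum_(T : {set X}) \sum_(W in D T) random_subset_pmf q W * p ^+ #|T|.
  under eq_bigr do rewrite mulr_sumr.
  rewrite (exchange_big_dep xpredT) //=; apply: eq_bigr => T _.
  by apply: eq_bigl => W; rewrite !inE.
have step T : \sum_(W in D T) random_subset_pmf q W * p ^+ #|T| <=
    \sum_(Z in E T) random_subset_pmf q Z * (p / q) ^+ m.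
  have injD : {in D T &, injective (fun W => W :|: T)}.
    move=> W W'; rewrite [W \in _]inE [W' \in _]inE => /andP[TW _] /andP[TW' _] eqU.
    have [_ dW _] := fragmentsP TW; have [_ dW' _] := fragmentsP TW'.
    have setUTK (V : {set X}) : [disjoint V & T] -> (V :|: T) :\: T = V.
      by move=> /setDidPl dV; rewrite setDUl setDv setU0.
    by rewrite -(setUTK W dW) eqU setUTK.
  apply: (@le_trans _ _ (\sum_(W in D T)
      random_subset_pmf q (W :|: T) * (p / q) ^+ m)).
    apply: ler_sum => W; rewrite inE => /andP[TW mT].
    have [_ dW _] := fragmentsP TW.
    have := random_subset_pmf_le_setU q01 dW.
    have -> : p ^+ #|T| = q ^+ #|T| * (p / q) ^+ #|T|.
      by rewrite -exprMn mulrC divfK // gt_eqF.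
    rewrite mulrA => le1.
    apply: ler_pM => //; rewrite ?mulr_ge0 ?exprn_ge0 ?random_subset_pmf_ge0 //.
      by case/andP: q01.
    - by case/andP: pq01.
    by apply: ler_wiXn2l => //; case/andP: pq01.
  rewrite -(big_imset (fun Z => random_subset_pmf q Z * (p / q) ^+ m) injD) /=.
  rewrite [leRHS](big_setID [set W :|: T | W in D T]) /=.
  rewrite (setIidPr _) ?lerDl.
    apply: sumr_ge0 => Z _; rewrite mulr_ge0 ?random_subset_pmf_ge0 //.
    by rewrite exprn_ge0 //; case/andP: pq01.
  apply/subsetP => Z /imsetP[W]; rewrite inE => /andP[TW mT] ->.
  rewrite inE mT andbT; have [[S SH TS] _ _] := fragmentsP TW.
  have SWT : S \subset W :|: T by rewrite -subDset TS.
  have [eH eWT] := edgeP _ _ SH SWT.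
  exact: fragment_sub_edge TW eH eWT.
apply: le_trans (ler_sum _ (fun T _ => step T)) _.
rewrite (exchange_big_dep xpredT) //=.
apply: (@le_trans _ _ (\sum_(Z : {set X}) random_subset_pmf q Z * (4 * p / q) ^+ m)).
  apply: ler_sum => Z _.
  rewrite sumr_const -mulrnAr ler_wpM2l ?random_subset_pmf_ge0 //.
  rewrite -mulrA [(4 * _) ^+ m]exprMn -mulr_natl ler_wpM2r ?exprn_ge0 //.
    by case/andP: pq01.
  have -> : 4 = (2 ^ 2)%:R :> R by [].
  rewrite -natrX -expnM ler_nat.
  apply: (@leq_trans #|powerset (edge Z)|).
    apply/subset_leq_card/subsetP => T TE; rewrite powersetE.
    by have : Z \in E T := TE; rewrite inE => /andP[].
  by rewrite card_powerset leq_exp2l.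
by rewrite -mulr_suml sum_random_subset_pmf mul1r.
Qed.

(** A bound that is affine in the cost is preserved by taking expectations, so
    that rounds of exposure compose without Markov's inequality. *)
Definition miss_bound p m q a b := forall H,
  (forall S, S \in H -> (#|S| < m)%N) -> miss q H <= a + b * (1 - mincost p H).

(** One round: expose W of density r, pay for the fragments with at least m
    elements, and apply the hypothesis to the system of the others, which an
    independent subset of density q has to hit. *)
Lemma miss_bound_double p q r a b m : 0 < p <= r -> 0 <= q -> q + r <= 1 ->
    0 <= b -> miss_bound p m q a b ->
  miss_bound p (2 * m) (q + r) (a + b * (4 * p / r) ^+ m) b.
Proof.
move=> /andP[p0 pr] q0 qr1 b0 bnd H Hm; have r0 : 0 < r := lt_le_trans p0 pr.
have r01 : 0 <= r <= 1 by apply/andP; split; lra.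
pose small W := [set T in fragments H W | (#|T| < m)%N].
pose large W := [set T in fragments H W | (m <= #|T|)%N].
have missW W : \sum_(Z : {set X}) random_subset_pmf q Z * (~~ hits H (W :|: Z))%:R
    <= a + b * (1 - mincost p H) + b * cost p (large W).
  apply: (@le_trans _ _ (miss q (small W))).
    apply: ler_sum => Z _; apply: ler_wpM2l.
      by apply: random_subset_pmf_ge0; apply/andP; split; lra.
    rewrite ler_nat; case: (boolP (hits H _)) => //= nH.
    suff -> : ~~ hits (small W) Z by [].
    apply: contra nH => /exists_inP[T]; rewrite inE => /andP[TW _] TZ.
    have [[S SH TS] _ _] := fragmentsP TW; apply/exists_inP; exists S => //.
    by rewrite -subDset -TS.
  apply: le_trans (bnd (small W) _) _; first by move=> S; rewrite inE => /andP[].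
  rewrite -addrA lerD2l -mulrDr ler_wpM2l //.
  suff : mincost p H <= cost p (large W) + mincost p (small W) by lra.
  apply: mincost_split => [|S /(fragments_sub W)[T TW TS]]; first exact: ltW.
  exists T => //; rewrite in_setU [T \in small W]in_set [T \in large W]in_set.
  by rewrite TW ltnNge /= orNb.
rewrite addrC (le_trans (missD H (ltW r0) q0 _)) //; first by rewrite addrC.
rewrite /miss expectation_setU.
apply: (@le_trans _ _ (\sum_(W : {set X}) random_subset_pmf r W *
    (a + b * (1 - mincost p H) + b * cost p (large W)))).
  by apply: ler_sum => W _; rewrite ler_wpM2l ?random_subset_pmf_ge0.
under eq_bigr do rewrite mulrDr mulrCA.
rewrite big_split /= -mulr_suml sum_random_subset_pmf mul1r -mulr_sumr.
rewrite addrAC lerD2r lerD2l ler_wpM2l //.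
by apply: expected_fragments_cost; rewrite ?p0 //; case/andP: r01.
Qed.

End MinCost.

(** * Iterating and boosting *)

Section Iteration.
Variables (R : realType) (X : finType).
Implicit Types (p q a b : R) (H F : {set {set X}}).

Lemma miss_bound_weaken p m q a a' b : a <= a' ->
  @miss_bound R X p m q a b -> miss_bound X p m q a' b.
Proof. by move=> aa' bnd H /bnd /le_trans -> //; rewrite lerD2r. Qed.

(** Rounds of density 32p have error 8^-m at size bound m.  At size bounds
    2^n, 2^(n+1), ... the errors sum to less than 8^-n / 4. *)
Lemma miss_bound_iter p n j q a b : 0 < p -> 0 <= q -> 0 <= b ->
    q + (32 * p) *+ j <= 1 -> miss_bound X p (2 ^ n) q a b ->
  miss_bound X p (2 ^ (n + j)) (q + (32 * p) *+ j) (a + b * 8^-1 ^+ n / 4) b.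
Proof.
move=> p0 q0 b0 qj1 bnd.
(* The factor 1 - 2^-j makes the geometric sum provable by induction on j. *)
suff : miss_bound X p (2 ^ (n + j)) (q + (32 * p) *+ j)
    (a + b * 8^-1 ^+ n / 4 * (1 - 2^-1 ^+ j)) b.
  apply: miss_bound_weaken; rewrite lerD2l ler_piMr ?lerBlDr ?lerDl ?exprn_ge0 //.
  by rewrite !mulr_ge0 ?exprn_ge0.
elim: j qj1 => [|j IH] qj1.
  by rewrite addn0 mulr0n expr0 subrr mulr0 !addr0.
rewrite mulrSr addrA in qj1 *.
have q'1 : q + 32 * p *+ j <= 1 by apply: le_trans qj1; rewrite lerDl; lra.
have q'0 : 0 <= q + 32 * p *+ j.
  by rewrite addr_ge0 // mulrn_wge0 // mulr_ge0 // ltW.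
have pp : 0 < p <= 32 * p by rewrite p0; lra.
have := miss_bound_double pp q'0 qj1 b0 (IH q'1).
rewrite addnS expnS; apply: miss_bound_weaken.
rewrite -addrA lerD2l.
have -> : 4 * p / (32 * p) = 8^-1 by field; rewrite gt_eqF.
have le8 : 8^-1 ^+ (2 ^ (n + j)) <= 8^-1 ^+ n * (8^-1 * 2^-1 ^+ j) :> R.
  apply: (@le_trans _ _ (8^-1 ^+ (n + j).+1)).
    by apply: ler_wiXn2l => //; [lra | apply: ltn_expl].
  rewrite exprS exprD mulrCA ler_wpM2l ?exprn_ge0 // ler_wpM2l //.
  by rewrite lerXn2r ?nnegrE //; lra.
have := ler_wpM2l b0 le8; rewrite [2^-1 ^+ j.+1]exprS.
set x := 8^-1 ^+ n; set y := 2^-1 ^+ j; set z := 8^-1 ^+ _.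
lra.
Qed.

(** A system whose members are all empty is hit unless it has no member, and
    then its cost is 0. *)
Lemma miss_bound_base p : miss_bound X p (2 ^ 0) 0 0 1.
Proof.
move=> H H0; rewrite add0r mul1r.
have [->|/set0Pn[S SH]] := eqVneq H set0.
  have := mincost_set0 X p.
  have : miss 0 (set0 : {set {set X}}) <= 1 :> R by apply: miss_le1; rewrite lexx ler01.
  lra.
suff -> : miss 0 H = 0 :> R by rewrite subr_ge0 mincost_le1.
rewrite /miss big1 // => W _; suff -> : hits H W by rewrite mulr0.
apply/exists_inP; exists S => //.
by have := H0 _ SH; rewrite expn0 ltnS leqn0 cards_eq0 => /eqP ->; apply: sub0set.
Qed.

(** Independent repetition.  If the cost is at least 1/2 the hypothesis bounds
    each failure probability by 3/4; otherwise the right-hand side exceeds 1. *)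
Lemma miss_bound_boost p m q k : 0 <= q -> q *+ k <= 1 -> (0 < k)%N ->
  miss_bound X p m q 4^-1 1 -> miss_bound X p m (q *+ k) ((3 / 4) ^+ k) 2.
Proof.
move=> q0 qk1 k0 bnd H Hm.
have qk0 : 0 <= q *+ k by rewrite mulrn_wge0.
have q1 : q <= 1 by apply: le_trans qk1; rewrite -(prednK k0) mulrS lerDl mulrn_wge0.
have [c2|c2] := lerP 2^-1 (mincost p H).
  apply: (@le_trans _ _ ((3 / 4) ^+ k)).
    apply: le_trans (miss_mulrn _ q0 qk1) _.
    rewrite lerXn2r ?nnegrE ?miss_ge0 ?q0 //.
    by have := bnd _ Hm; lra.
  by rewrite lerDl mulr_ge0 // subr_ge0 mincost_le1.
have : miss (q *+ k) H <= 1 by rewrite miss_le1 ?qk0.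
have : 0 <= (3 / 4) ^+ k :> R by rewrite exprn_ge0.
lra.
Qed.

(** The boosted rounds come first because they are expensive: they are used only
    below size 2^k, where k rounds suffice; above that size the rounds already
    fail with probability exponentially small in k. *)
Lemma miss_le_of_mincost p H k n : 0 < p -> (0 < k)%N ->
    (32 * p) *+ (k * k + n) <= 1 ->
    (forall S, S \in H -> (#|S| < 2 ^ (k + n))%N) -> 1 <= mincost p H ->
  miss ((32 * p) *+ (k * k + n)) H <= 2 * (3 / 4) ^+ k.
Proof.
move=> p0 k0 kn1 Hm c1; have p32 : 0 <= 32 * p by lra.
have kk1 : (32 * p) *+ (k * k) <= 1.
  by apply: le_trans kn1; rewrite mulrnDr lerDl mulrn_wge0.
have k1 : (32 * p) *+ k <= 1.
  by apply: le_trans kk1; apply: ler_wpMn2l => //; rewrite leq_pmulr.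
have kq0 : 0 <= (32 * p) *+ k by rewrite mulrn_wge0.
have bnd1 : miss_bound X p (2 ^ k) ((32 * p) *+ k) 4^-1 1.
  have := @miss_bound_iter p 0 k 0 0 1; rewrite !add0r expr0 !mul1r.
  by apply => //; apply: miss_bound_base.
have bnd2 : miss_bound X p (2 ^ k) ((32 * p) *+ (k * k)) ((3 / 4) ^+ k) 2.
  by rewrite mulrnA; apply: miss_bound_boost; rewrite // -mulrnA.
rewrite mulrnDr in kn1 *.
have := miss_bound_iter p0 _ _ kn1 bnd2 => /(_ _ _)/(_ _ Hm).
rewrite mulrn_wge0 // => /(_ isT (ler0n _ 2)).
have : 8^-1 ^+ k <= (3 / 4) ^+ k :> R by rewrite lerXn2r ?nnegrE //; lra.
have : 0 <= 8^-1 ^+ k :> R by rewrite exprn_ge0.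
lra.
Qed.

(** If G covers F and does not contain the empty set, then
    1 <= sigma(F) <= sum of sigma(F_T) over T in G <= cost of G.  Members larger
    than w have weight 0, so they can be discarded. *)
Lemma mincost_spread (w : nat) (k : R) F : 1 <= k ->
  spread (geometric_profile w k) F ->
  1 <= mincost k^-1 [set S in F | (#|S| <= w)%N].
Proof.
move=> k1 [sigma [[sigma0 _] s0 sT]].
have k0 : 0 < k by apply: lt_le_trans k1.
have ki0 i : 0 <= k^-1 ^+ i by rewrite exprn_ge0 // invr_ge0 ltW.
have link_ge0 T : 0 <= link_weight F sigma T.
  by apply: sumr_ge0 => S /andP[/sigma0].
have linkT T : T != set0 -> ratr (link_weight F sigma T) <= k^-1 ^+ #|T|.
  move=> T0; apply: le_trans (sT _ T0) _; rewrite /geometric_profile.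
  have [Tw|Tw] := ltnP #|T| w.+1; first by rewrite nth_mkseq // exprVn.
  by rewrite nth_default ?size_mkseq.
have large0 S : S \in F -> (w < #|S|)%N -> sigma S = 0.
  move=> SF wS; apply: le_anti; rewrite sigma0 // andbT.
  have S0 : S != set0 by rewrite -card_gt0; apply: leq_ltn_trans wS.
  have := sT _ S0; rewrite /geometric_profile nth_default ?size_mkseq //.
  rewrite lerq0; apply: le_trans.
  rewrite /link_weight (bigD1 S) /= ?SF ?subxx //.
  by rewrite lerDl; apply: sumr_ge0 => V /andP[/andP[/sigma0]].
apply: le_bigmin => // G /coversP GF.
have [G0|G0] := boolP (set0 \in G).
  rewrite /cost (bigD1 set0) //= cards0 expr0 lerDl.
  by apply: sumr_ge0.
have -> : 1 = (geometric_profile w k)`_0.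
  by rewrite /geometric_profile nth_mkseq // expr0 invr1.
apply: le_trans s0 _.
apply: (@le_trans _ _ (ratr (\sum_(T in G) link_weight F sigma T))); last first.
  rewrite rmorph_sum; apply: ler_sum => T TG; apply: linkT.
  by apply: contraNneq G0 => <-.
rewrite ler_rat /weight /link_weight.
rewrite (exchange_big_dep (fun S => S \in F)) /=; last by move=> T S _ /andP[].
apply: ler_sum => S SF.
have [wS|wS] := ltnP w #|S|.
  by rewrite big1 large0.
have [|T TG TS] := GF S; first by rewrite inE SF.
rewrite (bigD1 T) /= ?TG ?SF //.
by rewrite lerDl; apply: sumr_ge0 => V _; apply: sigma0.
Qed.

End Iteration.

(** * From set systems to the profile *)

Lemma geometric_profile_weight (R : realType) (w : nat) (k : R) : 1 <= k ->
  weight_profile (geometric_profile w k).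
Proof.
move=> k1; have k0 : 0 < k by apply: lt_le_trans k1.
split.
- by rewrite /geometric_profile nth_mkseq // expr0 invr1.
- apply/(sortedP 0) => i; rewrite size_mkseq => iw.
  rewrite /geometric_profile !nth_mkseq ?(ltnW iw) //=.
  by rewrite lef_pV2 ?posrE ?exprn_gt0 // ler_weXn2l.
apply/allP => x /mapP[i _ ->].
by rewrite invr_ge0 exprn_ge0 // ltW.
Qed.

Lemma geometric_profile_satisfying (R : realType) (alpha beta kap : R) (w k n : nat) :
    0 < alpha < 1 -> 1 <= kap -> (0 < k)%N -> (w < 2 ^ n)%N ->
    (32 * kap^-1) *+ (k * k + n) <= alpha -> 2 * (3 / 4) ^+ k < beta ->
  profile_satisfying alpha beta (geometric_profile w kap).
Proof.
move=> /andP[a0 a1] kap1 k0 wn le_a lt_b.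
split; first exact: geometric_profile_weight.
move=> X F spF; rewrite /satisfying.
have kap0 : 0 < kap^-1 by rewrite invr_gt0; apply: lt_le_trans kap1.
pose H := [set S in F | (#|S| <= w)%N].
have Hm S : S \in H -> (#|S| < 2 ^ (k + n))%N.
  rewrite inE => /andP[_ Sw]; apply: leq_ltn_trans Sw (leq_trans wn _).
  by rewrite leq_exp2l // leq_addl.
have q0 : 0 <= (32 * kap^-1) *+ (k * k + n) by rewrite mulrn_wge0 //; lra.
have a01 : 0 <= alpha <= 1 by rewrite !ltW.
have le_1 := le_trans le_a (ltW a1).
have missH := miss_le_of_mincost kap0 k0 le_1 Hm (mincost_spread kap1 spF).
have := miss_anti H q0 le_a (ltW a1).
rewrite -[X in _ < X]/(random_subset_prob alpha (hits F)) random_subset_prob_hits.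
suff : miss alpha F <= miss alpha H by lra.
apply: ler_sum => W _; rewrite ler_wpM2l ?random_subset_pmf_ge0 // ler_nat.
case hF: (hits F W) => //=; suff -> : ~~ hits H W by [].
apply: contraFN hF => /exists_inP[S]; rewrite inE => /andP[SF _] SW.
by apply/exists_inP; exists S.
Qed.

(** * Choosing the numbers of rounds *)

Section Numerics.
Variable R : realType.
Implicit Types (beta : R).

Lemma ln2_ge_half : 2^-1 <= ln (2 : R).
Proof.
rewrite -[2^-1]opprK -[ln 2]opprK lerN2 -lnV ?posrE // -[leRHS]expRK.
rewrite ler_ln ?posrE ?expR_gt0 //.
by apply: le_trans (expR_ge1Dx _); lra.
Qed.

Lemma exists_boost beta : 0 < beta < 1 ->
  exists k : nat, [/\ (0 < k)%N, 2 * (3 / 4) ^+ k < beta &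
    k%:R <= 5 + 4 * ln beta^-1].
Proof.
move=> /andP[b0 b1].
have B0 : 0 < ln beta^-1 by rewrite ln_gt0 // invf_gt1.
set B := ln beta^-1 in B0 *.
have x0 : 0 <= 4 * (1 + B) by lra.
(* Since 3/4 <= exp(-1/4), an exponent k > 4 (1 + B) gives (3/4)^k < beta / e. *)
exists (Num.truncn (4 * (1 + B))).+1; split => //; last first.
  have := x0; rewrite -truncn_le mulrSr; lra.
have := truncnS_gt (4 * (1 + B)); set k := (Num.truncn _).+1 => ltk.
have e34 : 3 / 4 <= expR (- 4^-1) :> R by apply: le_trans (expR_ge1Dx _); lra.
have : (3 / 4) ^+ k <= expR (k%:R * - 4^-1) :> R.
  by rewrite expRM_natl lerXn2r ?nnegrE ?expR_ge0.
have : expR (k%:R * - 4^-1 : R) < expR (- 1 - B).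
  by rewrite ltr_expR; lra.
have : expR (-1 - B) = expR (-1) * beta :> R.
  by rewrite expRD expRN /B lnK ?posrE ?invr_gt0 // invrK.
have : expR (-1) <= 2^-1 :> R.
  by rewrite expRN lef_pV2 ?posrE ?expR_gt0 //; apply: le_trans (expR_ge1Dx _); lra.
nra.
Qed.

Lemma exists_rounds (w : nat) : (0 < w)%N ->
  exists n : nat, (w < 2 ^ n)%N /\ n%:R <= 1 + 2 * ln (w%:R : R).
Proof.
move=> w0; have /andP[le_w lt_w] := trunc_log_bounds (isT : (1 < 2)%N) w0.
exists (trunc_log 2 w).+1; split => //.
set t := trunc_log 2 w in le_w *.
rewrite mulrS lerD2l.
have : ln (2 ^+ t) <= ln (w%:R : R).
  by rewrite ler_ln ?posrE ?exprn_gt0 ?ltr0n // -natrX ler_nat.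
rewrite lnXn // -[_ *+ t]mulr_natr; have := ler_wpM2r (ler0n R t) ln2_ge_half.
lra.
Qed.

End Numerics.

Theorem theorem2p5 (R : realType) :
  exists C : R, 0 < C /\
    forall (alpha beta : R) (w : nat),
      0 < alpha < 1 -> 0 < beta < 1 -> (2 <= w)%N ->
      (kappa w alpha beta <=
        (C / alpha ^+ 2 *
          (log (w%:R : R) * log (log (w%:R : R)) + log (1 / beta) ^+ 2))%:E)%E.
Proof.
pose l : R := ln (19 / 10).
have l0 : 0 < l by rewrite ln_gt0 //; lra.
have l1 : l <= 1.
  have e : 1 + 9 / 10 = 19 / 10 :> R by lra.
  by rewrite /l -e; apply: le_trans (le_ln1Dx _) _; lra.
have le_divl (x : R) : 0 <= x -> x <= x / l.
  by move=> x0; rewrite ler_pdivlMr // ler_piMr.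
pose d := log (log (2 : R)).
have d0 : 0 < d.
  rewrite /d /log divr_gt0 // ln_gt0 // ltr_pdivlMr // mul1r.
  by rewrite ltr_ln ?posrE; lra.
(* 104 bounds the coefficients in k^2 + n <= 104 (ln w + ln(1/beta)^2), and
   d^-1 trades ln w for the product with the iterated logarithm. *)
pose C : R := 32 * 104 * (1 + d^-1).
have dV0 : 0 < d^-1 by rewrite invr_gt0.
exists C; split; first by rewrite /C; nra.
move=> alpha beta w al be w2.
have [a0 a1] := andP al; have [b0 b1] := andP be.
have w0 : (0 < w)%N by apply: ltnW.
have [k [k0 kb kB]] := exists_boost be.
have [n [wn nW]] := @exists_rounds R w w0.
have B0 : 0 < ln beta^-1 by rewrite ln_gt0 // invf_gt1.
have W0 : 2^-1 <= ln (w%:R : R).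
  apply: le_trans (@ln2_ge_half R) _.
  by rewrite ler_ln ?posrE ?ltr0n // ler_nat.
have logW : ln (w%:R : R) <= log (w%:R : R) by rewrite /log -/l; apply: le_divl; lra.
have logB : ln beta^-1 <= log (1 / beta).
  by rewrite /log -/l mul1r; apply: le_divl; lra.
have loglogW : d <= log (log (w%:R : R)).
  have log2 : 0 < log (2 : R) by rewrite divr_gt0 // ln_gt0 //; lra.
  have log2w : log (2 : R) <= log (w%:R : R).
    rewrite /log ler_pM2r ?invr_gt0 //.
    by rewrite ler_ln ?posrE ?ltr0n // ler_nat.
  rewrite /d {1 3}/log ler_pM2r ?invr_gt0 // ler_ln ?posrE //.
  exact: lt_le_trans log2w.
pose m : R := (k * k + n)%:R.
have m1 : 1 <= m by rewrite /m ler1n addn_gt0 muln_gt0 k0.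
pose kap := 32 * m / alpha.
have kap1 : 1 <= kap by rewrite /kap ler_pdivlMr //; nra.
have sat : profile_satisfying alpha beta (geometric_profile w kap).
  apply: (@geometric_profile_satisfying _ _ _ _ _ k n) => //.
  rewrite -mulr_natr -/m /kap le_eqVlt; apply/orP; left; apply/eqP; field.
  by rewrite !gt_eqF //; lra.
apply: (@le_trans _ _ kap%:E).
  by apply: ereal_inf_lbound; exists kap.
rewrite lee_fin /kap.
set Lw := log (w%:R : R) in logW loglogW *.
set LLw := log Lw in loglogW *.
set Lb := log (1 / beta) in logB *.
set B := ln beta^-1 in kB B0 logB.
set W := ln _ in nW W0 logW.
have mle : 32 * m <= C * (Lw * LLw + Lb ^+ 2).
  have mE : m = k%:R ^+ 2 + n%:R by rewrite /m natrD natrM.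
  have kk : k%:R ^+ 2 <= 50 + 32 * B ^+ 2.
    apply: (@le_trans _ _ ((5 + 4 * B) ^+ 2)).
      by rewrite lerXn2r ?nnegrE ?ler0n //; lra.
    have := sqr_ge0 (5 - 4 * B); lra.
  have m104 : m <= 104 * (W + B ^+ 2) by rewrite mE; nra.
  have LL : W * d <= Lw * LLw by apply: ler_pM; lra.
  have BB : B ^+ 2 <= Lb ^+ 2 by rewrite lerXn2r ?nnegrE //; lra.
  have Cd : 104 * 32 * (W + B ^+ 2) <= C * (W * d + B ^+ 2).
    have -> : C * (W * d + B ^+ 2) =
       104 * 32 * (W + B ^+ 2) + 104 * 32 * (W * d + d^-1 * B ^+ 2).
      by rewrite /C; field; rewrite gt_eqF.
    rewrite lerDl mulr_ge0 // addr_ge0 // mulr_ge0 //; nra.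
  have C0 : 0 <= C by rewrite /C; nra.
  have := ler_wpM2l C0 (lerD LL BB).
  lra.
rewrite [leRHS]mulrAC.
apply: (@le_trans _ _ (C * (Lw * LLw + Lb ^+ 2) / alpha)).
  by rewrite ler_pM2r ?invr_gt0.
apply: ler_wpM2l; first by apply: le_trans mle; lra.
by rewrite lef_pV2 ?posrE ?exprn_gt0 // expr2 ler_piMl // ltW.
Qed.
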